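(* Let $(\mathcal{C},\otimes,1)$ be a monoidal category which has coequalizers and in which every object is coflat. Let $\varphi:R\to S$ be an algebra morphism in $\mathcal{C}$. Then the following assertions are equivalent: (i) $\varphi$ is regular as an $R$-bimodule morphism in $\mathcal{C}$, i.e. there exists an $R$-bimodule morphism $E:S\to R$ in $\mathcal{C}$ such that $\varphi\circ E\circ\varphi=\varphi$; (ii) there exists an $R$-bimodule morphism $E:S\to R$ in $\mathcal{C}$ such that $\varphi\circ E\circ u_S=u_S$. If one of these equivalent conditions holds, then (iii) the induction functor $\varphi^*=-\otimes_R S:\mathcal{C}_R\to\mathcal{C}_S$ is semiseparable. Moreover, if $1$ is a left $\otimes$-generator in $\mathcal{C}$, then (iii) is equivalent to both (i) and (ii).
   Context: Associativity and unit constraints are suppressed. For an algebra $A$ in a monoidal category $\mathcal{C}$, $m_A$ and $u_A:1\to A$ are its multiplication and unit, and $\mathcal{C}_A$ (resp. ${}_A\mathcal{C}$) is the category of right (resp. left) $A$-modules in $\mathcal{C}$. An object $X$ is coflat if both functors $X\otimes-$ and $-\otimes X$ preserve coequalizers. For $M\in\mathcal{C}_A$ with action $\nu:M\otimes A\to M$ and $X\in{}_A\mathcal{C}$ with action $\mu:A\otimes X\to X$, $q^A_{M,X}:M\otimes X\to M\otimes_A X$ denotes the coequalizer of $\nu\otimes\mathrm{Id}_X$ and $\mathrm{Id}_M\otimes\mu$. Given an algebra morphism $\varphi:R\to S$, $S$ is an $R$-bimodule via $m_S(\varphi\otimes\mathrm{Id}_S)$ and $m_S(\mathrm{Id}_S\otimes\varphi)$.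 The induction functor $\varphi^*=-\otimes_R S:\mathcal{C}_R\to\mathcal{C}_S$ sends $X$ to $X\otimes_R S$, with right $S$-action determined by $\nu\,(q^R_{X,S}\otimes\mathrm{Id}_S)=q^R_{X,S}(\mathrm{Id}_X\otimes m_S)$, and sends $f:X\to Y$ to the unique morphism $f\otimes_R S$ with $(f\otimes_R S)q^R_{X,S}=q^R_{Y,S}(f\otimes\mathrm{Id}_S)$. An object $P$ is a left $\otimes$-generator of $\mathcal{C}$ if for any morphisms $f,g:Y\otimes Z\to W$ in $\mathcal{C}$ with $f(\varepsilon\otimes\mathrm{Id}_Z)=g(\varepsilon\otimes\mathrm{Id}_Z)$ for all $\varepsilon:P\to Y$ in $\mathcal{C}$, one has $f=g$. A functor $F:\mathcal{A}\to\mathcal{B}$ induces the natural transformation $\mathcal{F}:\mathrm{Hom}_{\mathcal{A}}(-,-)\to\mathrm{Hom}_{\mathcal{B}}(F-,F-)$, $f\mapsto F(f)$. $F$ is semiseparable if there is a natural transformation $\mathcal{P}:\mathrm{Hom}_{\mathcal{B}}(F-,F-)\to\mathrm{Hom}_{\mathcal{A}}(-,-)$ with $\mathcal{F}\circ\mathcal{P}\circ\mathcal{F}=\mathcal{F}$. *)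

(* Defs.v *)
From Stdlib Require Import ProofIrrelevance ClassicalEpsilon.
From Corelib Require Import ssreflect.

Set Implicit Arguments.
Unset Strict Implicit.
Unset Printing Implicit Defensive.

Declare Scope cat_scope.
Delimit Scope cat_scope with cat.
Local Open Scope cat_scope.

Record Category := {
  Ob :> Type;
  Hom : Ob -> Ob -> Type;
  idm : forall X, Hom X X;
  comp : forall X Y Z, Hom Y Z -> Hom X Y -> Hom X Z;
  comp_idl : forall X Y (f : Hom X Y), comp (idm Y) f = f;
  comp_idr : forall X Y (f : Hom X Y), comp f (idm X) = f;
  compA : forall W X Y Z (h : Hom Y Z) (g : Hom X Y) (f : Hom W X),
    comp h (comp g f) = comp (comp h g) f }.

Arguments Hom {c} X Y.
Arguments idm {c} X.
Arguments comp {c X Y Z} g f : rename.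

Notation "g ∘ f" := (comp g f) (at level 40, left associativity) : cat_scope.

Lemma comp_r (C : Category) (V W X Y : C) (h : Hom X Y) (g : Hom W X)
    (k : Hom W Y) (f : Hom V W) : h ∘ g = k -> h ∘ (g ∘ f) = k ∘ f.
Proof. by move=> <-; rewrite compA. Qed.

Record Functor (A B : Category) := {
  fobj :> A -> B;
  fmap : forall X Y : A, Hom X Y -> Hom (fobj X) (fobj Y);
  fmap_id : forall X : A, fmap (idm X) = idm (fobj X);
  fmap_comp : forall (X Y Z : A) (g : Hom Y Z) (f : Hom X Y),
    fmap (g ∘ f) = fmap g ∘ fmap f }.

Arguments fmap {A B} F {X Y} f : rename.

(* Naturality in both variables, Hom_A(-,-) and Hom_B(F-,F-) being functors
   A^op x A -> Set. *)
Definition hom_natural (A B : Category) (F : Functor A B)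
    (P : forall X Y : A, Hom (F X) (F Y) -> Hom X Y) : Prop :=
  forall (X X' Y Y' : A) (h : Hom X' X) (k : Hom Y Y') (f : Hom (F X) (F Y)),
    P X' Y' (fmap F k ∘ f ∘ fmap F h) = k ∘ P X Y f ∘ h.

Definition semiseparable (A B : Category) (F : Functor A B) : Prop :=
  exists P : forall X Y : A, Hom (F X) (F Y) -> Hom X Y,
    hom_natural P /\
    forall (X Y : A) (f : Hom X Y), fmap F (P X Y (fmap F f)) = fmap F f.

Definition is_coequalizer (C : Category) (X Y Q : C)
    (f g : Hom X Y) (q : Hom Y Q) : Prop :=
  q ∘ f = q ∘ g /\
  forall (Z : C) (h : Hom Y Z), h ∘ f = h ∘ g ->
    exists! k : Hom Q Z, k ∘ q = h.

Record Coequalizer (C : Category) (X Y : C) (f g : Hom X Y) := {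
  coeq_ob : C;
  coeq_map : Hom Y coeq_ob;
  coeqP : is_coequalizer f g coeq_map }.

(* Data rather than mere existence: the objects M ⊗_A X below are built from the
   chosen coequalizers. *)
Definition has_coequalizers (C : Category) : Type :=
  forall (X Y : C) (f g : Hom X Y), Coequalizer f g.

Definition preserves_coequalizers (A B : Category) (F : Functor A B) : Prop :=
  forall (X Y Q : A) (f g : Hom X Y) (q : Hom Y Q),
    is_coequalizer f g q ->
    is_coequalizer (fmap F f) (fmap F g) (fmap F q).

Section CoequalizerFactorization.
Variables (C : Category) (X Y Q : C) (f g : Hom X Y) (q : Hom Y Q).
Hypothesis cq : is_coequalizer f g q.

Definition coeq_desc (Z : C) (h : Hom Y Z) (e : h ∘ f = h ∘ g) : Hom Q Z :=
  proj1_sig (constructive_indefinite_description _ (proj2 cq Z h e)).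

Lemma coeq_descE (Z : C) (h : Hom Y Z) (e : h ∘ f = h ∘ g) :
  coeq_desc e ∘ q = h.
Proof.
rewrite /coeq_desc; case: constructive_indefinite_description => k [] /=.
by [].
Qed.

Lemma coeq_epi (Z : C) (k k' : Hom Q Z) : k ∘ q = k' ∘ q -> k = k'.
Proof.
move=> e; have e' : k' ∘ q ∘ f = k' ∘ q ∘ g by rewrite -!compA (proj1 cq).
have [k0 [_ u]] := proj2 cq Z _ e'.
by rewrite -(u _ e) -(u k' eq_refl).
Qed.
End CoequalizerFactorization.

Record MonoidalCategory := {
  mcat :> Category;
  unit_ob : mcat;
  tens : mcat -> mcat -> mcat;
  tensm : forall X X' Y Y' : mcat,
    Hom X X' -> Hom Y Y' -> Hom (tens X Y) (tens X' Y');
  tensm_id : forall X Y : mcat, tensm (idm X) (idm Y) = idm (tens X Y);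
  tensm_comp : forall (X X' X'' Y Y' Y'' : mcat)
    (f' : Hom X' X'') (f : Hom X X') (g' : Hom Y' Y'') (g : Hom Y Y'),
    tensm (f' ∘ f) (g' ∘ g) = tensm f' g' ∘ tensm f g;
  assoc : forall X Y Z : mcat, Hom (tens (tens X Y) Z) (tens X (tens Y Z));
  assocV : forall X Y Z : mcat, Hom (tens X (tens Y Z)) (tens (tens X Y) Z);
  assocK : forall X Y Z : mcat, assocV X Y Z ∘ assoc X Y Z = idm _;
  assocVK : forall X Y Z : mcat, assoc X Y Z ∘ assocV X Y Z = idm _;
  assoc_nat : forall (X X' Y Y' Z Z' : mcat)
    (f : Hom X X') (g : Hom Y Y') (h : Hom Z Z'),
    assoc X' Y' Z' ∘ tensm (tensm f g) h = tensm f (tensm g h) ∘ assoc X Y Z;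
  lunit : forall X : mcat, Hom (tens unit_ob X) X;
  lunitV : forall X : mcat, Hom X (tens unit_ob X);
  lunitK : forall X : mcat, lunitV X ∘ lunit X = idm _;
  lunitVK : forall X : mcat, lunit X ∘ lunitV X = idm _;
  lunit_nat : forall (X Y : mcat) (f : Hom X Y),
    lunit Y ∘ tensm (idm unit_ob) f = f ∘ lunit X;
  runit : forall X : mcat, Hom (tens X unit_ob) X;
  runitV : forall X : mcat, Hom X (tens X unit_ob);
  runitK : forall X : mcat, runitV X ∘ runit X = idm _;
  runitVK : forall X : mcat, runit X ∘ runitV X = idm _;
  runit_nat : forall (X Y : mcat) (f : Hom X Y),
    runit Y ∘ tensm f (idm unit_ob) = f ∘ runit X;
  pentagon : forall W X Y Z : mcat,
    tensm (idm W) (assoc X Y Z) ∘ assoc W (tens X Y) Z ∘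
      tensm (assoc W X Y) (idm Z)
    = assoc W X (tens Y Z) ∘ assoc (tens W X) Y Z;
  triangle : forall X Y : mcat,
    tensm (idm X) (lunit Y) ∘ assoc X unit_ob Y = tensm (runit X) (idm Y) }.

Arguments unit_ob {m}.
Arguments tens {m} X Y : rename.
Arguments tensm {m X X' Y Y'} f g : rename.
Arguments assoc {m} X Y Z : rename.
Arguments assocV {m} X Y Z : rename.
Arguments lunit {m} X : rename.
Arguments lunitV {m} X : rename.
Arguments runit {m} X : rename.
Arguments runitV {m} X : rename.

Notation "𝟙" := unit_ob : cat_scope.
Notation "X ⊗ Y" := (tens X Y) (at level 34, left associativity) : cat_scope.
Notation "f ⊗₁ g" := (tensm f g) (at level 34, left associativity) : cat_scope.

Section Tensoring.
Variables (C : MonoidalCategory) (X : C).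

Fact tensor_left_comp (Y Y' Y'' : C) (g : Hom Y' Y'') (f : Hom Y Y') :
  idm X ⊗₁ (g ∘ f) = (idm X ⊗₁ g) ∘ (idm X ⊗₁ f).
Proof. by rewrite -tensm_comp comp_idl. Qed.

Fact tensor_right_comp (Y Y' Y'' : C) (g : Hom Y' Y'') (f : Hom Y Y') :
  (g ∘ f) ⊗₁ idm X = (g ⊗₁ idm X) ∘ (f ⊗₁ idm X).
Proof. by rewrite -tensm_comp comp_idl. Qed.

Fact tensor_swap (Y Y' Z Z' : C) (f : Hom Y Y') (g : Hom Z Z') :
  (idm Y' ⊗₁ g) ∘ (f ⊗₁ idm Z) = (f ⊗₁ idm Z') ∘ (idm Y ⊗₁ g).
Proof. by rewrite -!tensm_comp !comp_idl !comp_idr. Qed.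

Definition tensor_left : Functor C C := {|
  fobj := fun Y : C => X ⊗ Y;
  fmap := fun Y Y' (f : Hom Y Y') => idm X ⊗₁ f;
  fmap_id := tensm_id X;
  fmap_comp := tensor_left_comp |}.

Definition tensor_right : Functor C C := {|
  fobj := fun Y : C => Y ⊗ X;
  fmap := fun Y Y' (f : Hom Y Y') => f ⊗₁ idm X;
  fmap_id := fun Y => tensm_id Y X;
  fmap_comp := tensor_right_comp |}.

Definition coflat : Prop :=
  preserves_coequalizers tensor_left /\ preserves_coequalizers tensor_right.
End Tensoring.

Lemma assoc_inj (C : MonoidalCategory) (V X Y Z : C)
    (f g : Hom V ((X ⊗ Y) ⊗ Z)) :
  assoc X Y Z ∘ f = assoc X Y Z ∘ g -> f = g.
Proof.
by move=> e; rewrite -[f]comp_idl -[g]comp_idl -assocK -!compA e.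
Qed.

Lemma tens_unit_inj (C : MonoidalCategory) (X Y : C) (f g : Hom X Y) :
  f ⊗₁ idm 𝟙 = g ⊗₁ idm 𝟙 -> f = g.
Proof.
move=> e; rewrite -[f]comp_idr -[g]comp_idr -runitVK !compA.
by rewrite -!runit_nat e.
Qed.

Lemma runit_tens (C : MonoidalCategory) (X Y : C) :
  (idm X ⊗₁ runit Y) ∘ assoc X Y 𝟙 = runit (X ⊗ Y).
Proof.
apply: tens_unit_inj; apply: assoc_inj.
rewrite -triangle tensor_right_comp -tensm_id.
rewrite (comp_r _ (assoc_nat _ _ _)) -triangle tensor_left_comp.
rewrite (comp_r _ (assoc_nat _ _ _)) -!compA; apply: (f_equal (comp _)).
by rewrite compA pentagon.
Qed.

Definition left_tensor_generator (C : MonoidalCategory) (P : C) : Prop :=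
  forall (Y Z W : C) (f g : Hom (Y ⊗ Z) W),
    (forall e : Hom P Y, f ∘ (e ⊗₁ idm Z) = g ∘ (e ⊗₁ idm Z)) -> f = g.

Record Algebra (C : MonoidalCategory) := {
  alg_ob :> C;
  mul : Hom (alg_ob ⊗ alg_ob) alg_ob;
  eta : Hom 𝟙 alg_ob;
  mulA : mul ∘ (mul ⊗₁ idm alg_ob)
         = mul ∘ (idm alg_ob ⊗₁ mul) ∘ assoc alg_ob alg_ob alg_ob;
  mul_etal : mul ∘ (eta ⊗₁ idm alg_ob) = lunit alg_ob;
  mul_etar : mul ∘ (idm alg_ob ⊗₁ eta) = runit alg_ob }.

Arguments mul {C} a.
Arguments eta {C} a.

Record AlgebraMorphism (C : MonoidalCategory) (R S : Algebra C) := {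
  alg_hom :> Hom (R : C) (S : C);
  alg_hom_mul : alg_hom ∘ mul R = mul S ∘ (alg_hom ⊗₁ alg_hom);
  alg_hom_eta : alg_hom ∘ eta R = eta S }.

Section Modules.
Variables (C : MonoidalCategory) (A : Algebra C).

Record RightModule := {
  rmod_ob :> C;
  ract : Hom (rmod_ob ⊗ A) rmod_ob;
  ractA : ract ∘ (ract ⊗₁ idm A)
          = ract ∘ (idm rmod_ob ⊗₁ mul A) ∘ assoc rmod_ob A A;
  ract_eta : ract ∘ (idm rmod_ob ⊗₁ eta A) = runit rmod_ob }.

Record LeftModule := {
  lmod_ob :> C;
  lact : Hom (A ⊗ lmod_ob) lmod_ob;
  lactA : lact ∘ (mul A ⊗₁ idm lmod_ob)
          = lact ∘ (idm A ⊗₁ lact) ∘ assoc A A lmod_ob;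
  lact_eta : lact ∘ (eta A ⊗₁ idm lmod_ob) = lunit lmod_ob }.

Record Bimodule := {
  bimod_ob :> C;
  blact : Hom (A ⊗ bimod_ob) bimod_ob;
  bract : Hom (bimod_ob ⊗ A) bimod_ob;
  blactA : blact ∘ (mul A ⊗₁ idm bimod_ob)
           = blact ∘ (idm A ⊗₁ blact) ∘ assoc A A bimod_ob;
  blact_eta : blact ∘ (eta A ⊗₁ idm bimod_ob) = lunit bimod_ob;
  bractA : bract ∘ (bract ⊗₁ idm A)
           = bract ∘ (idm bimod_ob ⊗₁ mul A) ∘ assoc bimod_ob A A;
  bract_eta : bract ∘ (idm bimod_ob ⊗₁ eta A) = runit bimod_ob;
  blract : bract ∘ (blact ⊗₁ idm A)
           = blact ∘ (idm A ⊗₁ bract) ∘ assoc A bimod_ob A }.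

Record RightModuleMorphism (M N : RightModule) := {
  rmod_hom :> Hom (M : C) (N : C);
  rmod_homP : rmod_hom ∘ ract M = ract N ∘ (rmod_hom ⊗₁ idm A) }.

Record BimoduleMorphism (M N : Bimodule) := {
  bimod_hom :> Hom (M : C) (N : C);
  bimod_homl : bimod_hom ∘ blact M = blact N ∘ (idm A ⊗₁ bimod_hom);
  bimod_homr : bimod_hom ∘ bract M = bract N ∘ (bimod_hom ⊗₁ idm A) }.

Definition left_module_of (M : Bimodule) : LeftModule := {|
  lmod_ob := M; lact := blact M; lactA := blactA M; lact_eta := blact_eta M |}.

Lemma rmod_hom_inj (M N : RightModule) (f g : RightModuleMorphism M N) :
  (f : Hom (M : C) (N : C)) = g -> f = g.
Proof.
case: f g => [f fP] [g gP] /= e; case: _ / e gP => gP.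
by rewrite (proof_irrelevance _ fP gP).
Qed.

Fact rmod_idP (M : RightModule) :
  idm (M : C) ∘ ract M = ract M ∘ (idm (M : C) ⊗₁ idm A).
Proof. by rewrite tensm_id comp_idl comp_idr. Qed.

Definition rmod_id (M : RightModule) : RightModuleMorphism M M :=
  {| rmod_hom := idm (M : C); rmod_homP := rmod_idP M |}.

Fact rmod_compP (M N P : RightModule)
    (g : RightModuleMorphism N P) (f : RightModuleMorphism M N) :
  (g ∘ f) ∘ ract M = ract P ∘ ((g ∘ f) ⊗₁ idm A).
Proof.
by rewrite -compA rmod_homP compA rmod_homP tensor_right_comp compA.
Qed.

Definition rmod_comp (M N P : RightModule)
    (g : RightModuleMorphism N P) (f : RightModuleMorphism M N) :
    RightModuleMorphism M P :=
  {| rmod_hom := g ∘ f; rmod_homP := rmod_compP g f |}.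

Fact rmod_comp_idl (M N : RightModule) (f : RightModuleMorphism M N) :
  rmod_comp (rmod_id N) f = f.
Proof. by apply: rmod_hom_inj; apply: comp_idl. Qed.

Fact rmod_comp_idr (M N : RightModule) (f : RightModuleMorphism M N) :
  rmod_comp f (rmod_id M) = f.
Proof. by apply: rmod_hom_inj; apply: comp_idr. Qed.

Fact rmod_compA (L M N P : RightModule) (h : RightModuleMorphism N P)
    (g : RightModuleMorphism M N) (f : RightModuleMorphism L M) :
  rmod_comp h (rmod_comp g f) = rmod_comp (rmod_comp h g) f.
Proof. by apply: rmod_hom_inj; apply: compA. Qed.

Definition RightModules : Category := {|
  Ob := RightModule;
  Hom := RightModuleMorphism;
  idm := rmod_id;
  comp := rmod_comp;
  comp_idl := rmod_comp_idl;
  comp_idr := rmod_comp_idr;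
  compA := rmod_compA |}.

Definition regular_bimodule : Bimodule := {|
  bimod_ob := A; blact := mul A; bract := mul A;
  blactA := mulA A; blact_eta := mul_etal A;
  bractA := mulA A; bract_eta := mul_etar A;
  blract := mulA A |}.

Variable coeq : has_coequalizers C.

Definition tens_over_coeq (M : RightModule) (X : LeftModule) :
    Coequalizer (ract M ⊗₁ idm X) ((idm M ⊗₁ lact X) ∘ assoc M A X) :=
  coeq _ _.

Definition tens_over (M : RightModule) (X : LeftModule) : C :=
  coeq_ob (tens_over_coeq M X).

Definition tens_over_map (M : RightModule) (X : LeftModule) :
    Hom (M ⊗ X) (tens_over M X) :=
  coeq_map (tens_over_coeq M X).
End Modules.

Section RestrictedBimodule.
Variables (C : MonoidalCategory) (R S : Algebra C) (phi : AlgebraMorphism R S).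

Let la : Hom (R ⊗ S) (S : C) := mul S ∘ (phi ⊗₁ idm (S : C)).
Let ra : Hom (S ⊗ R) (S : C) := mul S ∘ (idm (S : C) ⊗₁ phi).

Fact restr_blactA :
  la ∘ (mul R ⊗₁ idm (S : C)) = la ∘ (idm (R : C) ⊗₁ la) ∘ assoc R R S.
Proof.
transitivity (mul S ∘ (mul S ⊗₁ idm (S : C)) ∘ ((phi ⊗₁ phi) ⊗₁ idm (S : C))).
  rewrite /la -!compA -!tensor_right_comp -alg_hom_mul.
  by [].
rewrite mulA /la -!compA assoc_nat.
apply: (f_equal (comp _)).
by rewrite !compA -!tensm_comp !comp_idl !comp_idr.
Qed.

Fact restr_blact_eta : la ∘ (eta R ⊗₁ idm (S : C)) = lunit (S : C).
Proof. by rewrite /la -compA -tensor_right_comp alg_hom_eta mul_etal. Qed.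

Fact restr_bractA :
  ra ∘ (ra ⊗₁ idm (R : C)) = ra ∘ (idm (S : C) ⊗₁ mul R) ∘ assoc S R R.
Proof.
transitivity (mul S ∘ (mul S ⊗₁ idm (S : C)) ∘ ((idm (S : C) ⊗₁ phi) ⊗₁ phi)).
  by rewrite /ra -!compA -!tensm_comp !comp_idl comp_idr.
rewrite mulA /ra -!compA assoc_nat.
apply: (f_equal (comp _)).
by rewrite !compA -!tensor_left_comp alg_hom_mul.
Qed.

Fact restr_bract_eta : ra ∘ (idm (S : C) ⊗₁ eta R) = runit (S : C).
Proof. by rewrite /ra -compA -tensor_left_comp alg_hom_eta mul_etar. Qed.

Fact restr_blract :
  ra ∘ (la ⊗₁ idm (R : C)) = la ∘ (idm (R : C) ⊗₁ ra) ∘ assoc R S R.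
Proof.
transitivity (mul S ∘ (mul S ⊗₁ idm (S : C)) ∘ ((phi ⊗₁ idm (S : C)) ⊗₁ phi)).
  by rewrite /ra /la -!compA -!tensm_comp !comp_idl comp_idr.
rewrite mulA /ra /la -!compA assoc_nat.
apply: (f_equal (comp _)).
by rewrite !compA -!tensm_comp !comp_idl !comp_idr.
Qed.

Fact restr_lact_mul :
  mul S ∘ (la ⊗₁ idm (S : C))
  = la ∘ (idm (R : C) ⊗₁ mul S) ∘ assoc R S S.
Proof.
rewrite /la tensor_right_comp compA mulA -!compA assoc_nat.
by rewrite tensm_id (comp_r _ (tensor_swap _ _)) -!compA.
Qed.

Definition restricted_bimodule : Bimodule R := {|
  bimod_ob := S; blact := la; bract := ra;
  blactA := restr_blactA; blact_eta := restr_blact_eta;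
  bractA := restr_bractA; bract_eta := restr_bract_eta;
  blract := restr_blract |}.
End RestrictedBimodule.

Section Induction.
Variables (C : MonoidalCategory) (coeq : has_coequalizers C).
Hypothesis coflatC : forall X : C, coflat X.
Variables (R S : Algebra C) (phi : AlgebraMorphism R S).

Let S_ : LeftModule R := left_module_of (restricted_bimodule phi).
Definition ind_ob (M : RightModule R) : C := tens_over coeq M S_.
Definition ind_map (M : RightModule R) : Hom (M ⊗ S) (ind_ob M) :=
  tens_over_map coeq M S_.
Let cq (M : RightModule R) := coeqP (tens_over_coeq coeq M S_).
Let cqr (X : C) (M : RightModule R) := proj2 (coflatC X) _ _ _ _ _ _ (cq M).
Let cqrr (M : RightModule R) := proj2 (coflatC S) _ _ _ _ _ _ (cqr S M).

Fact qE (M : RightModule R) :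
  ind_map M ∘ (ract M ⊗₁ idm (S : C))
  = ind_map M ∘ (idm (M : C) ⊗₁ (mul S ∘ (phi ⊗₁ idm (S : C)))) ∘ assoc M R S.
Proof. by rewrite -compA; apply: (proj1 (cq M)). Qed.

Fact ind_act_compat (M : RightModule R) :
  (ind_map M ∘ (idm (M : C) ⊗₁ mul S) ∘ assoc M S S)
    ∘ ((ract M ⊗₁ idm (S : C)) ⊗₁ idm (S : C))
  = (ind_map M ∘ (idm (M : C) ⊗₁ mul S) ∘ assoc M S S)
    ∘ (((idm (M : C) ⊗₁ lact S_) ∘ assoc M R S) ⊗₁ idm (S : C)).
Proof.
rewrite [lact S_]/= -!compA assoc_nat tensm_id.
rewrite (comp_r _ (tensor_swap _ _)) -compA (comp_r _ (qE M)) -!compA.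
rewrite -tensm_id (comp_r _ (assoc_nat _ _ _)) -!compA.
rewrite tensor_right_comp (comp_r _ (assoc_nat _ _ _)) -!compA.
rewrite [in RHS](comp_r _ (eq_sym (tensor_left_comp _ _ _))) restr_lact_mul.
rewrite !tensor_left_comp -!compA; do 4!apply: (f_equal (comp _)).
by rewrite compA pentagon.
Qed.

(* The action on X ⊗_R S, characterized by ind_actE. *)
Definition ind_act (M : RightModule R) : Hom (ind_ob M ⊗ S) (ind_ob M) :=
  coeq_desc (cqr S M) (ind_act_compat M).

Lemma ind_actE (M : RightModule R) :
  ind_act M ∘ (ind_map M ⊗₁ idm (S : C))
  = ind_map M ∘ (idm (M : C) ⊗₁ mul S) ∘ assoc M S S.
Proof. exact: coeq_descE. Qed.

Fact ind_actA (M : RightModule R) :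
  ind_act M ∘ (ind_act M ⊗₁ idm (S : C))
  = ind_act M ∘ (idm (ind_ob M) ⊗₁ mul S) ∘ assoc (ind_ob M) S S.
Proof.
apply: (coeq_epi (cqrr M)) => /=.
transitivity (ind_map M ∘ (idm (M : C) ⊗₁ mul S)
  ∘ ((idm (M : C) ⊗₁ (idm (S : C) ⊗₁ mul S))
  ∘ (assoc M S (S ⊗ S) ∘ assoc (M ⊗ S) S S))).
- rewrite -!compA -!tensor_right_comp ind_actE -!compA !tensor_right_comp.
  rewrite (comp_r _ (ind_actE M)) -!compA (comp_r _ (assoc_nat _ _ _)) -!compA.
  rewrite (comp_r _ (eq_sym (tensor_left_comp _ _ _))) mulA.
  rewrite !tensor_left_comp -!compA; do 3!apply: (f_equal (comp _)).
  by rewrite compA pentagon.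
- rewrite -!compA assoc_nat tensm_id (comp_r _ (tensor_swap _ _)) -!compA.
  rewrite (comp_r _ (ind_actE M)) -!compA -tensm_id.
  by rewrite (comp_r _ (assoc_nat _ _ _)) -!compA.
Qed.

Fact ind_act_eta (M : RightModule R) :
  ind_act M ∘ (idm (ind_ob M) ⊗₁ eta S) = runit (ind_ob M).
Proof.
apply: (coeq_epi (cqr 𝟙 M)); rewrite runit_nat -runit_tens.
rewrite -!compA tensor_swap (comp_r _ (ind_actE M)) -!compA.
rewrite -tensm_id assoc_nat (comp_r _ (eq_sym (tensor_left_comp _ _ _))).
by rewrite mul_etar.
Qed.

Definition ind_module (M : RightModule R) : RightModule S := {|
  rmod_ob := ind_ob M; ract := ind_act M;
  ractA := ind_actA M; ract_eta := ind_act_eta M |}.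

Fact ind_hom_compat (M N : RightModule R) (f : RightModuleMorphism M N) :
  (ind_map N ∘ (f ⊗₁ idm (S : C))) ∘ (ract M ⊗₁ idm (S : C))
  = (ind_map N ∘ (f ⊗₁ idm (S : C))) ∘ ((idm (M : C) ⊗₁ lact S_) ∘ assoc M R S).
Proof.
rewrite -!compA -tensor_right_comp rmod_homP tensor_right_comp.
rewrite (comp_r _ (qE N)) -!compA assoc_nat tensm_id.
by rewrite (comp_r _ (tensor_swap _ _)) -!compA.
Qed.

Definition ind_hom (M N : RightModule R) (f : RightModuleMorphism M N) :
    Hom (ind_ob M) (ind_ob N) :=
  coeq_desc (cq M) (ind_hom_compat f).

Lemma ind_homE (M N : RightModule R) (f : RightModuleMorphism M N) :
  ind_hom f ∘ ind_map M = ind_map N ∘ (f ⊗₁ idm (S : C)).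
Proof. exact: coeq_descE. Qed.

Fact ind_homP (M N : RightModule R) (f : RightModuleMorphism M N) :
  ind_hom f ∘ ind_act M = ind_act N ∘ (ind_hom f ⊗₁ idm (S : C)).
Proof.
apply: (coeq_epi (cqr S M)); rewrite -!compA ind_actE -tensor_right_comp.
rewrite ind_homE tensor_right_comp (comp_r _ (ind_actE N)) -!compA.
rewrite assoc_nat tensm_id (comp_r _ (ind_homE f)) -!compA.
by rewrite (comp_r _ (tensor_swap _ _)) -!compA.
Qed.

Definition ind_morphism (M N : RightModule R) (f : RightModuleMorphism M N) :
    RightModuleMorphism (ind_module M) (ind_module N) :=
  {| rmod_hom := ind_hom f : Hom (ind_module M : C) (ind_module N : C);
     rmod_homP := ind_homP f |}.

Fact ind_morphism_id (M : RightModule R) :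
  ind_morphism (rmod_id M) = rmod_id (ind_module M).
Proof.
apply: rmod_hom_inj; apply: (coeq_epi (cq M)).
by rewrite ind_homE tensm_id comp_idl comp_idr.
Qed.

Fact ind_morphism_comp (M N P : RightModule R)
    (g : RightModuleMorphism N P) (f : RightModuleMorphism M N) :
  ind_morphism (rmod_comp g f) = rmod_comp (ind_morphism g) (ind_morphism f).
Proof.
apply: rmod_hom_inj; apply: (coeq_epi (cq M)).
rewrite ind_homE -compA ind_homE (comp_r _ (ind_homE g)) -compA.
by rewrite tensor_right_comp.
Qed.

Definition induction : Functor (RightModules R) (RightModules S) :=
  @Build_Functor (RightModules R) (RightModules S)
    ind_module ind_morphism ind_morphism_id ind_morphism_comp.
End Induction.

(* Main.v *)
(* A bimodule map E : S -> R with φ E u_S = u_S gives an R-linear natural map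
   N ⊗_R E : N ⊗_R S -> N, and P f is the composite of f with this map and with
   M -> M ⊗_R S.  Conversely, let π : S ⊗_R S -> S ≅ R ⊗_R S be the S-linear map
   given by the multiplication, a retraction of φ ⊗_R S, and put E = P π.  Then
   E φ = P (id), so that (E φ) ⊗_R S = id and φ E φ = φ.  As π commutes with left
   multiplication by r : 1 -> R, so does E by naturality; left linearity of E
   follows when 1 is a left ⊗-generator. *)
From Corelib Require Import ssreflect.
Require Import Defs.

Set Implicit Arguments.
Unset Strict Implicit.
Unset Printing Implicit Defensive.

Local Open Scope cat_scope.

(** * Coherence for units, and left multiplication by global elements of an algebra *)

Section MonoidalFacts.
Variable C : MonoidalCategory.

Lemma tens_unitl_inj (X Y : C) (f g : Hom X Y) :
  idm 𝟙 ⊗₁ f = idm 𝟙 ⊗₁ g -> f = g.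
Proof.
move=> e; rewrite -[f]comp_idr -[g]comp_idr -lunitVK !compA.
by rewrite -!lunit_nat e.
Qed.

Lemma assoc_epi (W X Y Z : C) (f g : Hom (X ⊗ (Y ⊗ Z)) W) :
  f ∘ assoc X Y Z = g ∘ assoc X Y Z -> f = g.
Proof.
by move=> e; rewrite -[f]comp_idr -[g]comp_idr -assocVK !compA e.
Qed.

Lemma tensm_assoc_epi (V W X Y Z : C) (f g : Hom ((X ⊗ (Y ⊗ Z)) ⊗ V) W) :
  f ∘ (assoc X Y Z ⊗₁ idm V) = g ∘ (assoc X Y Z ⊗₁ idm V) -> f = g.
Proof.
move=> e; rewrite -[f]comp_idr -[g]comp_idr -tensm_id -assocVK.
by rewrite tensor_right_comp !compA e.
Qed.

(** Kelly's argument: tensored with [𝟙] on the left and precomposed with associators, all of which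
    is reversible, the identity reduces to the pentagon, two triangles and naturality of [assoc]. *)
Lemma lunit_tens (X Y : C) :
  lunit (X ⊗ Y) ∘ assoc 𝟙 X Y = lunit X ⊗₁ idm Y.
Proof.
apply: tens_unitl_inj; apply: assoc_epi; apply: tensm_assoc_epi.
rewrite tensor_left_comp -!compA [(idm 𝟙 ⊗₁ assoc 𝟙 X Y) ∘ _]compA pentagon.
rewrite compA triangle -tensm_id -assoc_nat.
by rewrite [RHS]compA -assoc_nat -compA -tensor_right_comp triangle.
Qed.

Lemma lunitV_nat (X Y : C) (f : Hom X Y) :
  lunitV Y ∘ f = (idm 𝟙 ⊗₁ f) ∘ lunitV X.
Proof.
rewrite -[LHS]comp_idr -(lunitVK X) -[lunitV Y ∘ f ∘ _]compA.
by rewrite [f ∘ _]compA -lunit_nat !compA lunitK comp_idl.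
Qed.

Lemma lunitV_tens (X Y : C) :
  assoc 𝟙 X Y ∘ (lunitV X ⊗₁ idm Y) = lunitV (X ⊗ Y).
Proof.
rewrite -[LHS]comp_idl -lunitK -compA [lunit (X ⊗ Y) ∘ _]compA lunit_tens.
by rewrite -tensor_right_comp lunitVK tensm_id comp_idr.
Qed.

Lemma runit_epi (X Y : C) (f g : Hom X Y) :
  f ∘ runit X = g ∘ runit X -> f = g.
Proof.
by move=> e; rewrite -[f]comp_idr -[g]comp_idr -runitVK !compA e.
Qed.

Lemma tensm_runit_epi (X Y Z : C) (f g : Hom (X ⊗ Y) Z) :
  f ∘ (runit X ⊗₁ idm Y) = g ∘ (runit X ⊗₁ idm Y) -> f = g.
Proof.
move=> e; rewrite -[f]comp_idr -[g]comp_idr -tensm_id -runitVK.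
by rewrite tensor_right_comp !compA e.
Qed.

Lemma lunit_epi (X Y : C) (f g : Hom X Y) :
  f ∘ lunit X = g ∘ lunit X -> f = g.
Proof.
by move=> e; rewrite -[f]comp_idr -[g]comp_idr -lunitVK !compA e.
Qed.

Lemma tensm_split (X X' Y Y' : C) (f : Hom X X') (g : Hom Y Y') :
  f ⊗₁ g = (f ⊗₁ idm Y') ∘ (idm X ⊗₁ g).
Proof. by rewrite -tensm_comp comp_idl comp_idr. Qed.

Lemma mul_tensm_eta (A : Algebra C) (X : C) (f : Hom X (A : C)) :
  mul A ∘ (f ⊗₁ eta A) = f ∘ runit X.
Proof.
by rewrite -[f in LHS]comp_idl -[eta A]comp_idr tensm_comp compA mul_etar runit_nat.
Qed.

(** The map [x ↦ r x]. Associativity makes it right linear, so naturality in the module category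
    applies to it. *)
Definition lmul (A : Algebra C) (r : Hom 𝟙 (A : C)) : Hom (A : C) A :=
  mul A ∘ (r ⊗₁ idm (A : C)) ∘ lunitV (A : C).

Lemma lmul_lunit (A : Algebra C) (r : Hom 𝟙 (A : C)) :
  lmul r ∘ lunit (A : C) = mul A ∘ (r ⊗₁ idm (A : C)).
Proof. by rewrite /lmul -!compA lunitK comp_idr. Qed.

Lemma lmul_mul (A : Algebra C) (r : Hom 𝟙 (A : C)) :
  lmul r ∘ mul A = mul A ∘ (lmul r ⊗₁ idm (A : C)).
Proof.
rewrite /lmul !tensor_right_comp -!compA lunitV_nat.
rewrite [in RHS]compA mulA -!compA.
rewrite [assoc A A A ∘ _]compA assoc_nat -!compA lunitV_tens tensm_id.
by rewrite [(idm A ⊗₁ mul A) ∘ _]compA tensor_swap !compA.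
Qed.

Lemma alg_hom_lmul (A B : Algebra C) (phi : AlgebraMorphism A B)
    (r : Hom 𝟙 (A : C)) :
  phi ∘ lmul r = lmul (phi ∘ r) ∘ phi.
Proof.
rewrite /lmul !compA alg_hom_mul -!compA lunitV_nat.
rewrite !(compA (_ ⊗₁ _)).
by rewrite -!tensm_comp !comp_idl !comp_idr.
Qed.

Definition regular_rmodule (A : Algebra C) : RightModule A :=
  {| rmod_ob := A; ract := mul A; ractA := mulA A; ract_eta := mul_etar A |}.

Definition rmodule_of (A : Algebra C) (M : Bimodule A) : RightModule A :=
  {| rmod_ob := M; ract := bract M; ractA := bractA M; ract_eta := bract_eta M |}.

Definition lmul_rmodule (A : Algebra C) (r : Hom 𝟙 (A : C)) :
    RightModuleMorphism (regular_rmodule A) (regular_rmodule A) :=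
  {| rmod_hom := lmul r : Hom (regular_rmodule A : C) (regular_rmodule A);
     rmod_homP := lmul_mul r |}.
End MonoidalFacts.

Section Separability.
Variables (C : MonoidalCategory) (coeq : has_coequalizers C).
Hypothesis coflatC : forall X : C, coflat X.
Variables (R S : Algebra C) (phi : AlgebraMorphism R S).

Let SR : Bimodule R := restricted_bimodule phi.
Let S_ : LeftModule R := left_module_of SR.
Let cq (M : RightModule R) := coeqP (tens_over_coeq coeq M S_).
Let q := @ind_map C coeq R S phi.
Let Fob := @ind_ob C coeq R S phi.
Let act := @ind_act C coeq coflatC R S phi.

Lemma ind_map_epi (M : RightModule R) (X : C) (f g : Hom (Fob M) X) :
  f ∘ q M = g ∘ q M -> f = g.
Proof. exact: (coeq_epi (cq M)). Qed.

(** By coflatness of [X], tensoring [q M] with [X] gives a coequalizer again. *)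
Lemma ind_map_tens_epi (M : RightModule R) (X Y : C) (f g : Hom (Fob M ⊗ X) Y) :
  f ∘ (q M ⊗₁ idm X) = g ∘ (q M ⊗₁ idm X) -> f = g.
Proof. exact: (coeq_epi (proj2 (coflatC X) _ _ _ _ _ _ (cq M))). Qed.

(** * Consequences of a bimodule map [E : S -> R] *)

Section Regular.
Variable E : BimoduleMorphism SR (regular_bimodule R).

(** One direction precomposes with [eta R]. For the other, [φ(r) = φ(r) 1], so left linearity gives
    [E(φ(r)) = r E(1)], whence [φ(E(φ(r))) = φ(r) φ(E(1)) = φ(r)]. *)
Lemma regular_unit_iff :
  phi ∘ E ∘ phi = phi :> Hom (R : C) (S : C) <-> phi ∘ E ∘ eta S = eta S.
Proof.
split=> e; first by rewrite -(alg_hom_eta phi) compA e.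
apply: runit_epi.
have e1 : phi ∘ runit (R : C) = mul S ∘ (phi ⊗₁ idm (S : C)) ∘ (idm (R : C) ⊗₁ eta S).
  by rewrite -compA -tensm_split mul_tensm_eta.
have el : E ∘ (mul S ∘ (phi ⊗₁ idm (S : C))) = mul R ∘ (idm (R : C) ⊗₁ E)
  := bimod_homl E.
rewrite -!compA e1 [E ∘ _]compA el compA.
rewrite (compA phi) alg_hom_mul -!compA -!tensm_comp !comp_idr.
by rewrite !compA e comp_idl.
Qed.

Fact counit_compat (N : RightModule R) :
  (ract N ∘ (idm (N : C) ⊗₁ E)) ∘ (ract N ⊗₁ idm (S : C))
  = (ract N ∘ (idm (N : C) ⊗₁ E)) ∘ ((idm (N : C) ⊗₁ lact S_) ∘ assoc N R S).
Proof.
have el : E ∘ lact S_ = mul R ∘ (idm (R : C) ⊗₁ E) := bimod_homl E.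
rewrite -compA tensor_swap compA ractA -[RHS]compA [in RHS](compA (_ ⊗₁ _)).
rewrite -tensor_left_comp el tensor_left_comp -!compA -assoc_nat.
by rewrite tensm_id.
Qed.

(** This is [N ⊗_R E] followed by [N ⊗_R R ≅ N], that is [n ⊗ s ↦ n E(s)]. *)
Definition counit (N : RightModule R) : Hom (Fob N) N :=
  coeq_desc (cq N) (counit_compat N).

Lemma counitE (N : RightModule R) :
  counit N ∘ q N = ract N ∘ (idm (N : C) ⊗₁ E).
Proof. exact: coeq_descE. Qed.

(** Right linearity of [E] makes [counit] linear for the [R]-action on [N ⊗_R S] restricted along
    φ. *)
Lemma counit_act (N : RightModule R) :
  counit N ∘ (act N ∘ (idm (Fob N) ⊗₁ phi)) = ract N ∘ (counit N ⊗₁ idm (R : C)).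
Proof.
apply: ind_map_tens_epi.
have er : E ∘ (mul S ∘ (idm (S : C) ⊗₁ phi)) = mul R ∘ (E ⊗₁ idm (R : C))
  := bimod_homr E.
rewrite -!compA -tensor_right_comp counitE tensor_swap.
rewrite (comp_r _ (ind_actE coeq coflatC phi N)) -!compA.
rewrite (comp_r _ (counitE N)) -!compA -tensm_id assoc_nat.
rewrite [in LHS](comp_r _ (eq_sym (tensor_left_comp _ _ _))).
rewrite [in LHS](comp_r _ (eq_sym (tensor_left_comp _ _ _))).
rewrite er tensor_left_comp tensor_right_comp (comp_r _ (ractA N)) -!compA.
by rewrite assoc_nat.
Qed.

Lemma counit_nat (M N : RightModule R) (f : RightModuleMorphism M N) :
  counit N ∘ ind_hom coeq phi f = f ∘ counit M.
Proof.
apply: ind_map_epi.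
rewrite -!compA ind_homE counitE.
rewrite (comp_r _ (counitE N)) -compA tensor_swap.
by rewrite compA -rmod_homP -compA.
Qed.
End Regular.

(** * The adjunction unit [m ↦ m ⊗ 1] *)

Definition ind_unit (M : RightModule R) : Hom (M : C) (Fob M) :=
  q M ∘ (idm (M : C) ⊗₁ eta S) ∘ runitV (M : C).

Lemma ind_unit_runit (M : RightModule R) :
  ind_unit M ∘ runit (M : C) = q M ∘ (idm (M : C) ⊗₁ eta S).
Proof. by rewrite /ind_unit -!compA runitK comp_idr. Qed.

(** The scalar crosses the tensor sign: [m r ⊗ 1 = m ⊗ φ(r) 1]. *)
Lemma ind_unit_ract (M : RightModule R) :
  ind_unit M ∘ ract M = q M ∘ (idm (M : C) ⊗₁ phi).
Proof.
apply: runit_epi.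
rewrite -[LHS]compA -runit_nat [LHS]compA ind_unit_runit -!compA.
rewrite tensor_swap (comp_r _ (qE coeq phi M)) -!compA.
rewrite -tensm_id assoc_nat -runit_tens; apply: (f_equal (comp _)).
rewrite !compA -!tensor_left_comp -compA -tensm_split.
by rewrite mul_tensm_eta.
Qed.

Lemma ind_unit_act (M : RightModule R) :
  act M ∘ (ind_unit M ⊗₁ idm (S : C)) = q M.
Proof.
apply: tensm_runit_epi; rewrite -compA -tensor_right_comp ind_unit_runit.
rewrite tensor_right_comp (comp_r _ (ind_actE coeq coflatC phi M)) -!compA.
rewrite assoc_nat [in LHS](comp_r _ (eq_sym (tensor_left_comp _ _ _))).
by rewrite mul_etal triangle.
Qed.

Lemma ind_unit_linear (M : RightModule R) :
  ind_unit M ∘ ract M = act M ∘ (idm (Fob M) ⊗₁ phi) ∘ (ind_unit M ⊗₁ idm (R : C)).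
Proof. by rewrite -compA tensor_swap compA ind_unit_act ind_unit_ract. Qed.

Lemma ind_unit_nat (M N : RightModule R) (f : RightModuleMorphism M N) :
  ind_hom coeq phi f ∘ ind_unit M = ind_unit N ∘ f.
Proof.
apply: runit_epi; rewrite -[LHS]compA ind_unit_runit -[RHS]compA -runit_nat.
rewrite [RHS]compA ind_unit_runit -[RHS]compA tensor_swap.
by rewrite (comp_r _ (ind_homE _ _ f)) -!compA.
Qed.

(** * From a bimodule map to semiseparability *)

Section Retraction.
Variable E : BimoduleMorphism SR (regular_bimodule R).
Let F := induction coeq coflatC phi.

(** All three factors are [R]-linear; the middle one is [S]-linear and is restricted along φ. *)
Fact retr_homP (M N : RightModule R)
    (f : RightModuleMorphism (ind_module coeq coflatC phi M)
                             (ind_module coeq coflatC phi N)) :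
  (counit E N ∘ (f ∘ ind_unit M)) ∘ ract M
  = ract N ∘ ((counit E N ∘ (f ∘ ind_unit M)) ⊗₁ idm (R : C)).
Proof.
have fP : f ∘ act M = act N ∘ (rmod_hom f ⊗₁ idm (S : C)) := rmod_homP f.
move: (ind_unit_linear M); move: (ind_unit M) => j jP.
rewrite -!compA jP !tensor_right_comp.
rewrite (comp_r _ (eq_sym (counit_act E N))) -!compA.
apply: (f_equal (comp _)); rewrite (comp_r _ fP) -!compA.
by apply: (f_equal (comp _)); rewrite !compA tensor_swap.
Qed.

Definition retr_hom (M N : RightModules R) (f : Hom (F M) (F N)) : Hom M N :=
  Build_RightModuleMorphism (retr_homP f).

Lemma retr_hom_natural : hom_natural retr_hom.
Proof.
move=> X X' Y Y' h k f; apply: rmod_hom_inj => /=.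
have := ind_unit_nat h; move: (ind_unit X) (ind_unit X') => j j' jP.
by rewrite -!compA jP !compA counit_nat.
Qed.

Hypothesis EP : phi ∘ E ∘ eta S = eta S.

(** Here [n E(1) ⊗ s = n ⊗ φ(E(1)) s = n ⊗ s], the last equality by [EP]. *)
Lemma ind_map_counit_unit (N : RightModule R) :
  q N ∘ ((counit E N ∘ ind_unit N) ⊗₁ idm (S : C)) = q N.
Proof.
apply: tensm_runit_epi; rewrite -compA -tensor_right_comp -compA.
rewrite ind_unit_runit compA counitE -compA -tensor_left_comp.
rewrite tensor_right_comp (comp_r _ (qE coeq phi N)) -!compA assoc_nat.
rewrite [in LHS](comp_r _ (eq_sym (tensor_left_comp _ _ _))) -compA.
by rewrite -tensor_right_comp (compA phi) EP mul_etal triangle.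
Qed.

Lemma regular_semiseparable : semiseparable F.
Proof.
exists retr_hom; split=> [|X Y f]; first exact: retr_hom_natural.
apply: rmod_hom_inj; apply: ind_map_epi; rewrite /= !ind_homE /=.
(* Naturality of the unit turns [P (F f)] into [counit ∘ ind_unit ∘ f], whose first two factors are
   absorbed by [q Y]. *)
by rewrite ind_unit_nat compA tensor_right_comp compA ind_map_counit_unit.
Qed.
End Retraction.

(** * From semiseparability back to a bimodule map *)

Let RR := regular_rmodule R.
Let Sr := rmodule_of SR.
Let la : Hom (R ⊗ S) (S : C) := mul S ∘ (phi ⊗₁ idm (S : C)).

Lemma alg_hom_ract : phi ∘ ract RR = ract Sr ∘ (phi ⊗₁ idm (R : C)).
Proof. by rewrite alg_hom_mul /= -compA -tensm_comp comp_idl comp_idr. Qed.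

Definition alg_hom_rmodule : RightModuleMorphism RR Sr :=
  {| rmod_hom := phi : Hom (RR : C) Sr; rmod_homP := alg_hom_ract |}.

Lemma lmul_ract (s : Hom 𝟙 (S : C)) :
  lmul s ∘ ract Sr = ract Sr ∘ (lmul s ⊗₁ idm (R : C)).
Proof. by rewrite /= compA lmul_mul -!compA tensor_swap. Qed.

Definition lmul_restricted (s : Hom 𝟙 (S : C)) : RightModuleMorphism Sr Sr :=
  {| rmod_hom := lmul s : Hom (Sr : C) Sr; rmod_homP := lmul_ract s |}.

Fact ind_mul_compat :
  mul S ∘ (ract Sr ⊗₁ idm (S : C)) = mul S ∘ ((idm (Sr : C) ⊗₁ lact S_) ∘ assoc Sr R S).
Proof.
rewrite /= tensor_right_comp compA mulA -!compA assoc_nat.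
by rewrite [in LHS](comp_r _ (eq_sym (tensor_left_comp _ _ _))).
Qed.

Definition ind_mul : Hom (Fob Sr) (S : C) := coeq_desc (cq Sr) ind_mul_compat.

Lemma ind_mulE : ind_mul ∘ q Sr = mul S.
Proof. exact: coeq_descE. Qed.

Lemma ind_mul_ind_hom (f : RightModuleMorphism RR Sr) :
  ind_mul ∘ (ind_hom coeq phi f ∘ q RR) = mul S ∘ (f ⊗₁ idm (S : C)).
Proof. by rewrite ind_homE compA ind_mulE. Qed.

Lemma ind_mul_act : ind_mul ∘ act Sr = mul S ∘ (ind_mul ⊗₁ idm (S : C)).
Proof.
apply: ind_map_tens_epi.
rewrite -!compA -tensor_right_comp ind_mulE ind_actE -!compA.
by rewrite (comp_r _ ind_mulE) mulA -compA.
Qed.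

(** The isomorphism [S ≅ R ⊗_R S], [s ↦ 1 ⊗ s]. *)
Definition ind_lunitV : Hom (S : C) (Fob RR) :=
  q RR ∘ (eta R ⊗₁ idm (S : C)) ∘ lunitV (S : C).

Lemma ind_lunitV_lact : ind_lunitV ∘ la = q RR.
Proof.
have qRR : q RR ∘ (mul R ⊗₁ idm (S : C))
  = q RR ∘ (idm (R : C) ⊗₁ la) ∘ assoc R R S := qE coeq phi RR.
rewrite /ind_lunitV -!compA lunitV_nat [in LHS](compA (_ ⊗₁ _)).
rewrite -tensor_swap -lunitV_tens -!compA.
rewrite [in LHS](compA (_ ⊗₁ _) (assoc _ _ _)) -tensm_id -assoc_nat -!compA.
rewrite !compA -qRR -!compA -!tensor_right_comp compA mul_etal lunitVK.
by rewrite tensm_id comp_idr.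
Qed.

Lemma ind_lunitV_mul :
  ind_lunitV ∘ mul S = act RR ∘ (ind_lunitV ⊗₁ idm (S : C)).
Proof.
rewrite /ind_lunitV !tensor_right_comp -!compA lunitV_nat.
rewrite [in RHS](comp_r _ (ind_actE coeq coflatC phi RR)) -!compA.
apply: (f_equal (comp _)).
rewrite [assoc R S S ∘ _]compA assoc_nat -!compA lunitV_tens tensm_id.
by rewrite [(idm (R : C) ⊗₁ mul S) ∘ _]compA tensor_swap compA.
Qed.

(** The unit law splits [la], since [la ∘ (eta R ⊗₁ idm S)] is the invertible [lunit S]. *)
Lemma lact_epi (X : C) (f g : Hom (S : C) X) : f ∘ la = g ∘ la -> f = g.
Proof.
move=> e; apply: lunit_epi; rewrite -(restr_blact_eta phi) -/la.
by rewrite !(compA _ la) e.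
Qed.

Fact ind_retr_act :
  (ind_lunitV ∘ ind_mul) ∘ act Sr
  = act RR ∘ ((ind_lunitV ∘ ind_mul) ⊗₁ idm (S : C)).
Proof.
by rewrite -compA ind_mul_act compA ind_lunitV_mul tensor_right_comp compA.
Qed.

(* The S-linear map S ⊗_R S -> S ≅ R ⊗_R S, a retraction of φ ⊗_R S. *)
Definition ind_retr : RightModuleMorphism (ind_module coeq coflatC phi Sr)
    (ind_module coeq coflatC phi RR) :=
  {| rmod_hom := ind_lunitV ∘ ind_mul
       : Hom (ind_module coeq coflatC phi Sr : C) (ind_module coeq coflatC phi RR);
     rmod_homP := ind_retr_act |}.

(** On elements, [r ⊗ s ↦ φ(r) ⊗ s ↦ φ(r) s ↦ 1 ⊗ φ(r) s = r ⊗ s]. *)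
Lemma ind_retrK :
  rmod_comp ind_retr (ind_morphism coeq coflatC phi alg_hom_rmodule) = rmod_id _.
Proof.
apply: rmod_hom_inj; apply: ind_map_epi.
rewrite -compA ind_homE -compA [in LHS](compA ind_mul) ind_mulE.
by rewrite ind_lunitV_lact comp_idl.
Qed.

Lemma lmul_lact (r : Hom 𝟙 (R : C)) :
  lmul (phi ∘ r) ∘ la = la ∘ (lmul r ⊗₁ idm (S : C)).
Proof.
rewrite /la -[RHS]compA -tensor_right_comp alg_hom_lmul tensor_right_comp.
by rewrite !compA lmul_mul.
Qed.

Lemma ind_lunitV_lmul (r : Hom 𝟙 (R : C)) :
  ind_hom coeq phi (lmul_rmodule r) ∘ ind_lunitV = ind_lunitV ∘ lmul (phi ∘ r).
Proof.
apply: lact_epi; rewrite -[RHS]compA lmul_lact [RHS]compA.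
rewrite -[LHS]compA ind_lunitV_lact; exact: (ind_homE coeq phi (lmul_rmodule r)).
Qed.

(** Applying [P] to both sides will yield [E(φ(r) s) = r E(s)]. *)
Lemma ind_retr_lmul (r : Hom 𝟙 (R : C)) :
  rmod_comp ind_retr (ind_morphism coeq coflatC phi (lmul_restricted (phi ∘ r)))
  = rmod_comp (ind_morphism coeq coflatC phi (lmul_rmodule r)) ind_retr.
Proof.
apply: rmod_hom_inj; apply: ind_map_epi.
have e : ind_hom coeq phi (lmul_restricted (phi ∘ r)) ∘ q Sr
  = q Sr ∘ (lmul (phi ∘ r) ⊗₁ idm (S : C)) := ind_homE _ _ _.
rewrite -[LHS]compA [X in _ ∘ X]e -[LHS]compA (compA ind_mul) ind_mulE.
rewrite -lmul_mul -[RHS]compA -(compA ind_lunitV) ind_mulE.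
by rewrite [LHS]compA [RHS]compA ind_lunitV_lmul.
Qed.

Lemma semiseparable_regular :
  left_tensor_generator (𝟙 : C) -> semiseparable (induction coeq coflatC phi) ->
  exists E : BimoduleMorphism SR (regular_bimodule R),
    phi ∘ E ∘ phi = phi :> Hom (R : C) (S : C).
Proof.
move=> gen [P [Pnat PF]].
pose E : RightModuleMorphism Sr RR := P Sr RR ind_retr.
have El : E ∘ la = mul R ∘ (idm (R : C) ⊗₁ E).
  (* The generator hypothesis reduces left linearity to global elements [r] of [R]. *)
  apply: gen => r.
  (* Naturality of [P] is used once in the source, along multiplication by [φ ∘ r], and once in the
     target, along multiplication by [r]. *)
  have := Pnat Sr Sr RR RR (lmul_restricted (phi ∘ r)) (rmod_id _) ind_retr.
  have := Pnat Sr Sr RR RR (rmod_id _) (lmul_rmodule r) ind_retr.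
  rewrite /= !ind_morphism_id !rmod_comp_idl !rmod_comp_idr ind_retr_lmul.
  move=> -> /(f_equal (@rmod_hom _ _ _ _)) /= e.
  rewrite -!compA tensor_swap -tensor_right_comp -lmul_lunit compA -e.
  by rewrite -compA -lunit_nat !compA lmul_lunit.
have Er : E ∘ bract SR = mul R ∘ (E ⊗₁ idm (R : C)) := rmod_homP E.
exists {| bimod_hom := rmod_hom E : Hom (SR : C) (regular_bimodule R);
          bimod_homl := El; bimod_homr := Er |} => /=.
(* Naturality along φ in the source, with [ind_retrK]; then [PF] at the identity says that induction
   sends [E ∘ φ] to the identity. *)
have Ephi : rmod_comp E alg_hom_rmodule = P RR RR (rmod_id _).
  have := Pnat Sr RR RR RR alg_hom_rmodule (rmod_id _) ind_retr.
  by rewrite /= ind_morphism_id !rmod_comp_idl ind_retrK.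
have := PF RR RR (rmod_id _); rewrite /= ind_morphism_id -Ephi => FE.
have e : ind_hom coeq phi (rmod_comp alg_hom_rmodule (rmod_comp E alg_hom_rmodule))
         = ind_hom coeq phi alg_hom_rmodule.
  apply: (f_equal (@rmod_hom _ _ (ind_module coeq coflatC phi RR)
                                 (ind_module coeq coflatC phi Sr))
            (x := ind_morphism coeq coflatC phi _)
            (y := ind_morphism coeq coflatC phi _)).
  by rewrite ind_morphism_comp FE rmod_comp_idr.
(* Induction is injective on maps [f : R -> S]: multiplying out [F f] gives [r ⊗ s ↦ f(r) s], and
   [s = 1] recovers [f]. *)
have := ind_mul_ind_hom alg_hom_rmodule; rewrite -e ind_mul_ind_hom /= compA.
move=> /(f_equal (fun k => k ∘ (idm (R : C) ⊗₁ eta S))).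
by rewrite -!(compA (mul S)) -!tensm_split !mul_tensm_eta => /runit_epi.
Qed.
End Separability.

Theorem theorem3p5 (C : MonoidalCategory) (coeq : has_coequalizers C)
    (coflatC : forall X : C, coflat X)
    (R S : Algebra C) (phi : AlgebraMorphism R S) :
  let i := exists E : BimoduleMorphism (restricted_bimodule phi) (regular_bimodule R),
             phi ∘ E ∘ phi = phi :> Hom (R : C) (S : C) in
  let ii := exists E : BimoduleMorphism (restricted_bimodule phi) (regular_bimodule R),
              phi ∘ E ∘ eta S = eta S in
  let iii := semiseparable (induction coeq coflatC phi) in
  (i <-> ii) /\
  (i \/ ii -> iii) /\
  (left_tensor_generator (𝟙 : C) -> (iii <-> i) /\ (iii <-> ii)).
Proof.
move=> i ii iii.
have i_ii : i <-> ii by split=> -[E /regular_unit_iff EP]; exists E.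
have ii_iii : ii -> iii by case=> E; apply: regular_semiseparable.
have gen_i : left_tensor_generator (𝟙 : C) -> iii -> i
  by apply: semiseparable_regular.
tauto.
Qed.
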